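(* For every $n\ge1$ and every antichain $A$ of $\mathsf{A}^n$, $\mathrm{LK}(A)=\mathrm{rvac}_{\mathcal{A}}(A)$.
   Context: $\mathsf{A}^n$ is the poset of intervals $[i,j]=\{i,\dots,j\}$, $1\le i\le j\le n$, ordered by inclusion; it is graded of rank $r=n-1$ with $\mathrm{rk}([i,j])=j-i$, and $\mathsf{A}^n_k$ is the set of rank-$k$ elements. An antichain $A=\{[i_1,j_1],\dots,[i_k,j_k]\}$ with $i_1<\dots<i_k$ has $j_1<\dots<j_k$; $\mathrm{LK}(A)=\{[i'_1,j'_1],\dots,[i'_m,j'_m]\}$ with $\{i'_1<\dots<i'_m\}=\{1,\dots,n\}\setminus\{j_1,\dots,j_k\}$ and $\{j'_1<\dots<j'_m\}=\{1,\dots,n\}\setminus\{i_1,\dots,i_k\}$. Antichain toggle: $\tau_p(A)=A\cup\{p\}$ if $p\notin A$ and $A\cup\{p\}$ is an antichain, $A\setminus\{p\}$ if $p\in A$, else $A$. $\boldsymbol{\tau}_k=\prod_{p\in\mathsf{A}^n_k}\tau_p$. Products are compositions, rightmost first. $\mathrm{rvac}_{\mathcal{A}}=(\boldsymbol{\tau}_r)(\boldsymbol{\tau}_r\boldsymbol{\tau}_{r-1})\cdots(\boldsymbol{\tau}_r\cdots\boldsymbol{\tau}_1)(\boldsymbol{\tau}_r\cdots\boldsymbol{\tau}_1\boldsymbol{\tau}_0)$. *)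

(* Defs.v *)
From HB Require Import structures.
From mathcomp Require Import all_boot all_order.

Set Implicit Arguments.
Unset Strict Implicit.
Unset Printing Implicit Defensive.

Import Order.TTheory.

Section Toggles.
Context {d : Order.disp_t} {T : finPOrderType d}.
Implicit Types (p q : T) (A : {set T}).

Definition antichain A : bool :=
  [forall p in A, forall q in A, (p <= q)%O ==> (p == q)].

Definition toggle p A : {set T} :=
  if p \in A then A :\ p else if antichain (p |: A) then p |: A else A.

Variable rk : T -> nat.

(* The order in which the big operator enumerates the elements of rank [k] is
   irrelevant on antichains when such elements are pairwise incomparable:
   see [toggleC] and [rk_incomparable]. *)
Definition rank_toggle (k : nat) : {set T} -> {set T} :=
  \big[comp/id]_(p | rk p == k) toggle p.

(* For [r] the rank of the poset,
     rvac r = (t_r) (t_r t_(r-1)) ... (t_r ... t_1) (t_r ... t_1 t_0)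
   with [t_i = rank_toggle i]; as the sequences of indices are decreasing, the
   factor [k = 0] is applied first and, inside each factor, [t_k] is applied
   first. *)
Definition rvac (r : nat) : {set T} -> {set T} :=
  \big[comp/id]_(k <- rev (index_iota 0 r.+1))
    \big[comp/id]_(i <- rev (index_iota k r.+1)) rank_toggle i.

Lemma antichainP A :
  reflect {in A &, forall p q, (p <= q)%O -> p = q} (antichain A).
Proof.
apply: (iffP forallP) => [H p q pA qA le_pq|H p].
  have /implyP/(_ pA)/forallP/(_ q)/implyP/(_ qA)/implyP/(_ le_pq)/eqP := H p.
  exact.
apply/implyP => pA; apply/forallP => q; apply/implyP => qA; apply/implyP => le_pq.
by apply/eqP/H.
Qed.

Lemma antichain_sub A (B : {set T}) : A \subset B -> antichain B -> antichain A.
Proof.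
move=> sAB /antichainP aB; apply/antichainP => p q pA qA.
by apply: aB; apply: (subsetP sAB).
Qed.

Lemma toggle_antichain p A : antichain A -> antichain (toggle p A).
Proof.
rewrite /toggle => aA; case: ifP => _; last by case: ifP.
exact: antichain_sub (subsetDl _ _) aA.
Qed.

Lemma antichainU2 p q A :
  ~~ (p >=< q)%O ->
  antichain (p |: A) -> antichain (q |: A) -> antichain (p |: (q |: A)).
Proof.
rewrite /Order.comparable negb_or => /andP[npq nqp].
move=> /antichainP ap /antichainP aq; apply/antichainP => x y.
rewrite !inE => /or3P[/eqP->|/eqP->|xA] /or3P[/eqP->|/eqP->|yA] // le_xy;
  first [by rewrite le_xy in npq | by rewrite le_xy in nqp
        | by apply: ap; rewrite ?inE ?eqxx ?xA ?yA ?orbT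
        | by apply: aq; rewrite ?inE ?eqxx ?xA ?yA ?orbT].
Qed.

Lemma antichainU1D1 p q A :
  ~~ (p >=< q)%O -> q \in A ->
  antichain A -> antichain (p |: (A :\ q)) = antichain (p |: A).
Proof.
move=> npq qA aA; have Aq := setD1K qA.
apply/idP/idP => aP; last exact: antichain_sub (setUS _ (subD1set _ _)) aP.
by rewrite -Aq; apply: antichainU2; rewrite ?Aq.
Qed.

Lemma toggleC p q A :
  ~~ (p >=< q)%O -> antichain A ->
  toggle p (toggle q A) = toggle q (toggle p A).
Proof.
move=> npq aA.
have neq : p != q by apply: contraNneq npq => ->; rewrite comparablexx.
have neq' : q != p by rewrite eq_sym.
have nqp : ~~ (q >=< p)%O by rewrite comparable_sym.
have U2 x y : ~~ (x >=< y)%O -> antichain (y |: A) ->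
    antichain (x |: (y |: A)) = antichain (x |: A).
  move=> nxy ay; apply/idP/idP => [|ax]; last exact: antichainU2.
  by apply: antichain_sub; rewrite setUS // subsetUr.
rewrite /toggle.
case: (boolP (p \in A)) => pA; case: (boolP (q \in A)) => qA /=.
- by rewrite !inE pA qA neq neq' /= !setDDl setUC.
- rewrite !inE (negPf qA) andbF antichainU1D1 //.
  case: (boolP (antichain (q |: A))) => aq; rewrite ?inE ?pA ?orbT //.
  by apply/setP=> x; rewrite !inE; case: (eqVneq x q) => [->|] //; rewrite neq'.
- rewrite !inE (negPf pA) andbF antichainU1D1 //.
  case: (boolP (antichain (p |: A))) => ap; rewrite ?inE ?qA ?orbT //.
  by apply/setP=> x; rewrite !inE; case: (eqVneq x p) => [->|] //; rewrite neq.
case: (boolP (antichain (q |: A))) => aq; case: (boolP (antichain (p |: A))) => ap;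
  rewrite ?inE ?(negPf pA) ?(negPf qA) ?(negPf neq) ?(negPf neq') /=
    ?(negPf ap) ?(negPf aq) ?U2 ?ap ?aq ?(negPf ap) ?(negPf aq) //.
by rewrite setUCA.
Qed.

End Toggles.

(* Endpoints are elements of ['I_n]: the ordinal [i] stands for the point
   [i + 1] of {1, ..., n}. *)
Record intv (n : nat) := Intv {
  endpoints : 'I_n * 'I_n;
  _ : endpoints.1 <= endpoints.2
}.

HB.instance Definition _ n := [isSub for @endpoints n].
HB.instance Definition _ n := [Finite of intv n by <:].

Section Intervals.
Variable n : nat.
Implicit Types (p q : intv n) (A : {set intv n}).

Definition left p : 'I_n := (endpoints p).1.
Definition right p : 'I_n := (endpoints p).2.
Definition points p : {set 'I_n} := [set x : 'I_n | left p <= x <= right p].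

Lemma left_le_right p : left p <= right p.
Proof. by case: p. Qed.

Definition le_intv p q : bool := points p \subset points q.

Lemma le_intvE p q : le_intv p q = (left q <= left p) && (right p <= right q).
Proof.
apply/subsetP/andP => [H|[Hl Hr] x].
  have := H (left p); rewrite !inE leqnn left_le_right => /(_ isT)/andP[-> _].
  by have := H (right p); rewrite !inE leqnn left_le_right => /(_ isT)/andP[_ ->].
by rewrite !inE => /andP[/(leq_trans Hl)-> /leq_trans->].
Qed.

Lemma le_intv_refl : reflexive le_intv.
Proof. by move=> p; apply: subxx. Qed.

Lemma le_intv_anti : antisymmetric le_intv.
Proof.
move=> p q; rewrite !le_intvE => /andP[/andP[h1 h2] /andP[h3 h4]].
apply: val_inj => /=; move: h1 h2 h3 h4; rewrite /left /right.
case: (endpoints p) (endpoints q) => [a b] [c e] /= h1 h2 h3 h4.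
by congr pair; apply: val_inj; apply/eqP; rewrite eqn_leq ?h1 ?h2 ?h3 ?h4.
Qed.

Lemma le_intv_trans : transitive le_intv.
Proof. by move=> q p s; apply: subset_trans. Qed.

Definition rk p : nat := right p - left p.

End Intervals.

Fact intv_display : Order.disp_t. Proof. exact: Order.Disp tt tt. Qed.

HB.instance Definition _ n := Order.Le_isPOrder.Build intv_display (intv n)
  (@le_intv_refl n) (@le_intv_anti n) (@le_intv_trans n).

Section LK.
Variable n : nat.
Implicit Types (p q : intv n) (A : {set intv n}).

(* [enum] lists a set of ordinals in increasing order. *)
Definition LK_endpoints A : seq ('I_n * 'I_n) :=
  zip (enum (~: [set right p | p in A])) (enum (~: [set left p | p in A])).

(* When [A] is an antichain, all the pairs in [LK_endpoints A] are intervals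
   ([LK_endpoints_le]) and no complementary endpoint is left over
   ([LK_endpoints_size]), so that nothing is lost here. *)
Definition LK A : {set intv n} :=
  [set p | endpoints p \in LK_endpoints A].

Lemma intv_leE p q :
  (p <= q)%O = (left q <= left p) && (right p <= right q).
Proof. exact: le_intvE. Qed.

Lemma rk_incomparable p q : rk p = rk q -> p != q -> ~~ (p >=< q)%O.
Proof.
move=> epq; apply: contraNN => cpq; apply/eqP.
wlog le_pq : p q epq cpq / (p <= q)%O => [W|].
  have /orP[|le_qp] := cpq; first exact: W.
  by apply/esym/W; rewrite // comparable_sym.
apply/le_anti; rewrite le_pq /=.
move: le_pq; rewrite !intv_leE => /andP[hl hr].
have lp := left_le_right p; have lq := left_le_right q.
have e : right p + left q = right q + left p.
  rewrite -{1}(subnK lp) -{1}(subnK lq) -/(rk p) -/(rk q) epq.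
  by rewrite addnAC.
apply/andP; split.
  by rewrite -(leq_add2l (right q)) -e leq_add2r.
by rewrite -(leq_add2r (left q)) e leq_add2l.
Qed.

Lemma antichain_left_inj A : antichain A -> {in A &, injective (@left n)}.
Proof.
move=> /antichainP aA p q pA qA epq.
case/orP: (leq_total (right p) (right q)) => h; [|apply/esym];
  by apply: aA; rewrite // intv_leE epq leqnn.
Qed.

Lemma antichain_right_inj A : antichain A -> {in A &, injective (@right n)}.
Proof.
move=> /antichainP aA p q pA qA epq.
case/orP: (leq_total (left p) (left q)) => h; [apply/esym|];
  by apply: aA; rewrite // intv_leE epq leqnn andbT.
Qed.

Lemma LK_endpoints_size A : antichain A ->
  #|~: [set right p | p in A]| = #|~: [set left p | p in A]|.
Proof.
move=> aA; rewrite [LHS]cardsCs [RHS]cardsCs !setCK !card_in_imset //.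
  exact: antichain_left_inj.
exact: antichain_right_inj.
Qed.

Lemma all_zip_leq (s t : seq nat) : sorted ltn s -> sorted ltn t ->
  (forall m, count (fun x => x <= m) t <= count (fun x => x <= m) s) ->
  all (fun x => x.1 <= x.2) (zip s t).
Proof.
have gtS m x (u : seq nat) : path ltn x u -> m < x ->
    count (fun z => z <= m) u = 0.
  move=> pu mx; apply/eqP; rewrite -leqn0 leqNgt -has_count; apply/hasPn => z zu.
  rewrite -ltnNge (ltn_trans mx) //.
  by have /allP/(_ z zu) := order_path_min ltn_trans pu.
elim: s t => [|x s IH] [|y t] //= ps pt H.
have le_xy : x <= y.
  rewrite leqNgt; apply/negP => lt_yx; have := H y.
  by rewrite leqnn (leqNgt x) lt_yx (gtS _ _ _ ps lt_yx).
rewrite le_xy; apply: IH (path_sorted ps) (path_sorted pt) _ => m.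
case: (leqP y m) => [le_ym|lt_my]; last by rewrite (gtS _ _ _ pt).
by have := H m; rewrite le_ym (leq_trans le_xy le_ym) !add1n.
Qed.

Lemma sorted_enum_set (X : {set 'I_n}) : sorted ltn (map val (enum X)).
Proof.
apply: (subseq_sorted ltn_trans) (iota_ltn_sorted 0 n).
by rewrite -val_enum_ord; apply/map_subseq; rewrite enumT; apply: filter_subseq.
Qed.

Lemma LK_endpoints_le A :
  antichain A -> all (fun x : 'I_n * 'I_n => x.1 <= x.2) (LK_endpoints A).
Proof.
move=> aA.
have cnt (X : {set 'I_n}) m : count (fun x => x <= m) (map val (enum X)) =
    #|[set x : 'I_n | x <= m] :&: X|.
  rewrite count_map -size_filter cardE /enum_mem -filter_predI.
  by congr (size _); apply: eq_filter => x; rewrite /= !inE.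
have cntC (X : {set 'I_n}) m : #|[set x : 'I_n | x <= m] :&: ~: X| =
    #|[set x : 'I_n | x <= m]| - #|[set x : 'I_n | x <= m] :&: X|.
  by rewrite -setDE -(cardsID X [set x : 'I_n | x <= m]) addKn.
have := @all_zip_leq _ _ (sorted_enum_set (~: [set right p | p in A]))
  (sorted_enum_set (~: [set left p | p in A])).
have mapz (s t : seq 'I_n) : zip (map val s) (map val t) =
    [seq (val x.1, val x.2) | x <- zip s t].
  by elim: s t => [|x s IH] [|y t] //=; rewrite IH.
rewrite mapz all_map; apply=> m; rewrite !cnt !cntC leq_sub2l //.
have img (f : intv n -> 'I_n) : {in A &, injective f} ->
    #|[set x : 'I_n | x <= m] :&: [set f p | p in A]| =
    #|[set p in A | f p <= m]|.
  move=> fI; rewrite -(@card_in_imset _ _ f); last first.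
    by move=> p q; rewrite !inE => /andP[pA _] /andP[qA _]; apply: fI.
  congr #|pred_of_set _|; apply/setP => x; rewrite !inE.
  apply/andP/imsetP => [[xm /imsetP[p pA ex]]|[p]].
    by exists p; rewrite // inE pA -ex.
  by rewrite inE => /andP[pA pm] ->; split=> //; apply: imset_f.
rewrite !img; [|exact: antichain_left_inj|exact: antichain_right_inj].
apply/subset_leq_card/subsetP => p; rewrite !inE => /andP[-> pm].
exact: leq_trans (left_le_right p) pm.
Qed.

End LK.

(* Main.v *)
(* Write a(x) for the number of left ends < x of elements of A and b(x) for the
   number of right ends < x.  For s >= 0, the set obtained from A by the s first
   factors of rvac consists of
   - the elements of LK(A) of rank < s, where [x,y] is in LK(A) iff x is not a
     right end, y is not a left end and x - b(x) = y - a(y);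
   - the intervals [i_(t+s) - s, j_t + s] with i_(t+s) <= j_t + s, that
     is, the ends of A matched with an offset of s and spread by s on both
     sides.
   For s = 0 this is A, for s = n it is LK(A).  A factor acts on the part of
   rank >= s as a rowmotion, so going from s to s + 1 amounts to: an interval
   [x,y] of rank >= s lies below a shifted interval iff b(y-s) + s < a(x+s+1), and
   otherwise it contains an element of the next set, obtained by shrinking [x,y]
   as long as this inequality keeps failing. *)
Require Import Defs.
From mathcomp Require Import all_boot all_order zify.

Set Implicit Arguments.
Unset Strict Implicit.
Unset Printing Implicit Defensive.

Import Order.TTheory.

(** * Functions on the naturals with increments 0 or 1 *)

Definition unit_step (f : nat -> nat) := forall x, f x <= f x.+1 <= (f x).+1.

Lemma unit_step_leq f x y : unit_step f -> x <= y -> f x <= f y <= f x + (y - x).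
Proof.
move=> fS; elim: y => [|y IH]; first by rewrite leqn0 => /eqP->; rewrite leqnn leq_addr.
rewrite leq_eqVlt => /orP[/eqP->|]; first by rewrite leqnn leq_addr.
by rewrite ltnS => le_xy; have := IH le_xy; have := fS y; lia.
Qed.

(** Discrete intermediate value theorem: the crossing from [c] to [c.+1] locates a counted point by
    its index. *)
Lemma unit_step_ivt f c x y : unit_step f -> f x <= c < f y -> x <= y ->
  exists z, [/\ x <= z, z < y, f z = c & f z.+1 = c.+1].
Proof.
move=> fS; elim: y => [|y IH] fc; first by rewrite leqn0 => /eqP xE; move: fc; rewrite xE; lia.
rewrite leq_eqVlt => /orP[/eqP xE|]; first by move: fc; rewrite xE; lia.
rewrite ltnS => le_xy; case: (ltnP c (f y)) => [lt_cy|le_yc].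
  have [|z [? ? ? ?]] := IH _ le_xy; first by lia.
  by exists z; split; lia.
by exists y; have := fS y; split; lia.
Qed.

(** The condition [f 0 = 0] gives [f x <= x], so the subtraction is never truncated. *)
Lemma unit_step_subn f : f 0 = 0 -> unit_step f -> unit_step (fun x => x - f x).
Proof.
move=> f0 fS x; have := unit_step_leq fS (leq0n x); have := fS x; lia.
Qed.

(** * Inequalities between the counting functions of left and right ends *)

Section Endpoints.
Context (a b : nat -> nat).

(* [x - b x] is the index of [x] among the points that are not right ends, and
   [y - a y] that of [y] among those that are not left ends. *)
Definition LK_cond x y := [&& a y == a y.+1, b x == b x.+1 & x + a y == y + b x].

(* [x, y] = [i_(t+s) - s, j_t + s]: the last equation says that the left end
   [x + s] comes [s] places after the right end [y - s].  The first clause makes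
   the subtraction genuine. *)
Definition shifted_cond s x y :=
  [&& x + s <= y, a (x + s) < a (x + s).+1, b (y - s) < b (y - s).+1
    & a (x + s) == b (y - s) + s].

Context (aS : unit_step a) (bS : unit_step b).

Lemma below_shifted n s x y : a 0 = 0 -> a n = b n -> x + s <= y -> y < n ->
  (exists x' y', [/\ shifted_cond s x' y', x' <= x, y <= y' & y' < n])
  <-> b (y - s) + s < a (x + s).+1.
Proof.
move=> a0 ab_n le_xy lt_yn; split=> [[x' [y' [/and4P[h1 h2 h3 /eqP h4] h5 h6 h7]]]|H].
  have := @unit_step_leq a (x' + s).+1 (x + s).+1 aS.
  by have := @unit_step_leq b (y - s) (y' - s) bS; lia.
have h1 := @unit_step_leq a 0 s aS.
(* [u] is the left end of index [b (y - s) + s]; [a s <= s] ensures [s <= u]. *)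
have [||u [h2 h3 h4 h5]] := @unit_step_ivt a (b (y - s) + s) s (x + s).+1 aS; [lia..|].
have h6 := @unit_step_leq a (x + s).+1 n aS.
(* [v] is the right end of index [b (y - s)]; it exists before [n - s] because [b (n - s) + s >= b n
   = a n > b (y - s) + s]. *)
have [||v [h7 h8 h9 h10]] := @unit_step_ivt b (b (y - s)) (y - s) (n - s) bS; [|lia|].
  by have := @unit_step_leq b (n - s) n bS; lia.
exists (u - s), (v + s); split; try lia.
by apply/and4P; rewrite addnK subnK //; split; lia.
Qed.

(** The ends sought are the non-left end [v] and the non-right end [u] of common index [x - b x];
    [b <= a] yields [x <= v] and [u <= v]. *)
Lemma above_LK x y : a 0 = 0 -> b 0 = 0 -> (forall z, b z <= a z) ->
  a y.+1 + x <= b x + y ->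
  exists x' y', [/\ LK_cond x' y', x <= x', y' <= y & x' <= y'].
Proof.
move=> a0 b0 le_ba H.
have aL z := unit_step_leq aS (leq0n z); have bL z := unit_step_leq bS (leq0n z).
have gS := unit_step_subn a0 aS; have eS := unit_step_subn b0 bS.
have [||v [h1 h2 h3 h4]] := @unit_step_ivt _ (x - b x) 0 y.+1 gS.
- by have := aL y.+1; have := bL x; lia.
- by [].
have lt_vx : x <= v.
  rewrite leqNgt; apply/negP => lt; have := @unit_step_leq _ v.+1 x eS lt.
  by have := le_ba v.+1; lia.
have [||u [k1 k2 k3 k4]] := @unit_step_ivt _ (x - b x) x v.+1 eS.
- by have := le_ba v.+1; lia.
- by lia.
exists u, v; split; [|lia..].
apply/and3P; move: (aL v) (aL v.+1) (bL u) (bL u.+1) (aL y.+1) (bL x) => *; split; lia.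
Qed.

(** Nesting gives [x - b x <= x' - b x' = y' - a y' <= y - a y = x - b x], and these indices grow
    strictly past [x] and past [y']. *)
Lemma LK_cond_inj x y x' y' : LK_cond x y -> LK_cond x' y' ->
  x <= x' -> y' <= y -> x = x' /\ y = y'.
Proof.
move=> /and3P[/eqP h1 /eqP h2 /eqP h3] /and3P[/eqP k1 /eqP k2 /eqP k3] lx ly.
have := @unit_step_leq b x.+1 x' bS; have := @unit_step_leq b x x' bS.
have := @unit_step_leq a y'.+1 y aS; have := @unit_step_leq a y' y aS.
by lia.
Qed.

Lemma shifted_cond_inj s x y x' y' : shifted_cond s x y -> shifted_cond s x' y' ->
  x <= x' -> y' <= y -> x = x' /\ y = y'.
Proof.
move=> /and4P[h0 h1 h2 /eqP h3] /and4P[k0 k1 k2 /eqP k3] lx ly.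
have := @unit_step_leq a (x + s).+1 (x' + s) aS; have := @unit_step_leq a (x + s) (x' + s) aS.
have := @unit_step_leq b (y' - s).+1 (y - s) bS; have := @unit_step_leq b (y' - s) (y - s) bS.
by lia.
Qed.

Lemma LK_shifted_incomparable s x y u v : shifted_cond s x y -> LK_cond u v ->
  u <= v -> v < u + s -> x <= u -> v <= y -> False.
Proof.
move=> /and4P[h0 h1 h2 /eqP h3] /and3P[/eqP k1 /eqP k2 /eqP k3] uv vs xu vy.
case: (leqP u (y - s)) => uy.
  (* [a v.+1 = b u + v - u] gives [a (u + s) < b u + s], against [a (u + s) >= a (x + s) = b (y - s)
     + s >= b u + s]. *)
  have := @unit_step_leq a v.+1 (u + s) aS; have := @unit_step_leq a (x + s) (u + s) aS.
  by have := @unit_step_leq b u (y - s) bS; lia.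
(* The steps of [a] at [x + s] and of [b] at [y - s] bound [a v.+1 + (y - v)] below by
   [b (y - s) + s + 1] and above by [b (y - s) + s]. *)
have := @unit_step_leq b (y - s).+1 u bS; have := @unit_step_leq a v.+1 y.+1 aS.
have := @unit_step_leq a (x + s).+1 y.+1 aS; have := bS (y - s).
by lia.
Qed.

Definition stage_cond s x y := (y - x < s) && LK_cond x y || shifted_cond s x y.

Lemma stage_cond_inj s x y x' y' : x <= y -> x' <= y' ->
  stage_cond s x y -> stage_cond s x' y' ->
  x <= x' -> y' <= y -> x = x' /\ y = y'.
Proof.
move=> xy xy' /orP[/andP[r h]|h] /orP[/andP[r' h']|h'] lx ly.
- exact: LK_cond_inj.
(* A shifted interval has rank at least [s], so it does not fit inside one of rank below [s]. *)
- by case/and4P: h'; lia.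
- by case: (LK_shifted_incomparable h h'); lia.
- exact: shifted_cond_inj h h' lx ly.
Qed.

Lemma stage_cond_next s x y : s <= y - x -> x <= y -> stage_cond s.+1 x y ->
  a (x + s).+1 <= b (y - s) + s.
Proof.
move=> rs xy /orP[/andP[r /and3P[/eqP h1 /eqP h2 /eqP h3]]|/and4P[h0 h1 h2 /eqP h3]].
  (* Here the rank is exactly [s]. *)
  by have -> : y - s = x by [lia]; have -> : x + s = y by [lia]; lia.
have e : (y - s.+1).+1 = y - s by lia.
by move: h2 (bS (y - s.+1)); rewrite e -[(x + s).+1]addnS; lia.
Qed.

(** Shrink one end while the inequality survives. At rank [s], [above_LK] applies; if neither end
    can move, the two failures force the steps and the equation of [shifted_cond s.+1]. *)
Lemma stage_cond_exists s x y : a 0 = 0 -> b 0 = 0 -> (forall z, b z <= a z) ->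
  x + s <= y -> a (x + s).+1 <= b (y - s) + s ->
  exists x' y', [/\ stage_cond s.+1 x' y', x <= x', y' <= y & x' <= y'].
Proof.
move=> a0 b0 le_ba; have [k] := ubnP (y - x); elim: k x y => // k IH x y lk le_xy H.
case: (leqP y (x + s)) => [le_yx|lt_xy].
  have e : y = x + s by lia.
  have [|u [v [h1 h2 h3 h4]]] := @above_LK x y a0 b0 le_ba; first by move: H; rewrite e addnK; lia.
  exists u, v; split=> //; apply/orP; left; rewrite h1 andbT; lia.
case: (leqP (a (x.+1 + s).+1) (b (y - s) + s)) => [Hx|Hx].
  by have [||| u [v [? ? ? ?]]] := IH x.+1 y; try lia; exists u, v; split; lia.
case: (leqP (a (x + s).+1) (b (y.-1 - s) + s)) => [Hy|Hy].
  by have [||| u [v [? ? ? ?]]] := IH x y.-1; try lia; exists u, v; split; lia.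
exists x, y; split; try lia; apply/orP; right; rewrite /shifted_cond.
have e : (y - s.+1).+1 = y - s by lia.
have e' : y.-1 - s = y - s.+1 by lia.
move: Hy Hx (bS (y - s.+1)) (aS (x + s).+1); rewrite e e' !addSn !addnS.
by move=> *; apply/and4P; split; lia.
Qed.

End Endpoints.

(** * Rank toggles and partial rowmotion in a finite poset *)

Section Rowmotion.
Context {d : Order.disp_t} {T : finPOrderType d} (rk : T -> nat).
Implicit Types (p q : T) (A B C S : {set T}).

Lemma rank_toggle_antichain t S : antichain S -> antichain (rank_toggle rk t S).
Proof.
rewrite /rank_toggle; elim/big_ind: _ S => //= [f g fP gP S /gP/fP //|p _ S].
exact: toggle_antichain.
Qed.

Lemma antichainU1 p S : p \notin S -> antichain S ->
  antichain (p |: S) = [forall q in S, ~~ (p >=< q)%O].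
Proof.
move=> pS /antichainP aS; apply/antichainP/forall_inP => [aU q qS|nc x y].
  apply: contra pS => /orP[le|le]; [rewrite (aU p q)|rewrite -(aU q p)] => //;
    by rewrite !inE ?eqxx ?qS ?orbT.
rewrite !inE => /orP[/eqP->|xS] /orP[/eqP->|yS] // le; last exact: aS.
  by have := nc _ yS; rewrite /Order.comparable le.
by have := nc _ xS; rewrite /Order.comparable le orbT.
Qed.

Lemma eq_antichainU1 p S S' : p \notin S -> p \notin S' ->
  antichain S -> antichain S' ->
  (forall q, (p >=< q)%O -> (q \in S) = (q \in S')) ->
  antichain (p |: S) = antichain (p |: S').
Proof.
move=> pS pS' aS aS' eqS; rewrite !antichainU1 //; apply: eq_forallb => q.
by case: (boolP (p >=< q)%O) => [/eqS->|]; rewrite ?implybT.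
Qed.

Context (rkS : forall p q, (p < q)%O -> rk p < rk q).

Lemma eq_rk_incomparable p q : rk p = rk q -> p != q -> ~~ (p >=< q)%O.
Proof.
move=> e npq; apply/negP; rewrite comparable_sym /Order.comparable !le_eqVlt.
rewrite (negPf npq) eq_sym (negPf npq) /=.
by case/orP=> /rkS; rewrite e ltnn.
Qed.

(** Elements of equal rank are incomparable, so the toggles of one rank do not affect each other's
    tests and act simultaneously. *)
Lemma in_rank_toggle t S q : antichain S ->
  (q \in rank_toggle rk t S) =
    if rk q == t then (q \notin S) && antichain (q |: S) else q \in S.
Proof.
move=> aS; rewrite /rank_toggle.
suff H (s : seq T) : uniq s -> all (fun p => rk p == t) s ->
    let S' := (\big[comp/id]_(p <- s) toggle p) S in
    antichain S' /\ forall q, (q \in S') =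
      if q \in s then (q \notin S) && antichain (q |: S) else q \in S.
  rewrite -big_filter; case: (H [seq p <- index_enum T | rk p == t]) => [||_ ->].
  - by rewrite filter_uniq ?index_enum_uniq.
  - exact: filter_all.
  - by rewrite mem_filter mem_index_enum andbT.
elim: s => [|p s IH] /=; first by rewrite big_nil.
case/andP=> ps us /andP[/eqP rp rs]; rewrite big_cons /=.
have [/= aS' S'E] := IH us rs; set S' := (\big[_/_]_(_ <- _) _) S in aS' S'E *.
split=> [|x]; first exact: toggle_antichain.
have pS' : (p \in S') = (p \in S) by rewrite S'E (negPf ps).
have aE : p \notin S -> antichain (p |: S') = antichain (p |: S).
  move=> pS; apply: eq_antichainU1; rewrite ?pS' // => y py; rewrite S'E.
  case: ifP => // ys; have /eqP ry := allP rs _ ys.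
  case: (eqVneq p y) ps => [->|npy _]; first by rewrite ys.
  by case/negP: (eq_rk_incomparable (etrans rp (esym ry)) npy).
rewrite inE /toggle pS'; case: (eqVneq x p) => [->|nxp] /=.
  case: (boolP (p \in S)) => pS /=; first by rewrite !inE eqxx.
  by rewrite aE //; case: ifP => _; rewrite ?inE ?eqxx // pS' (negPf pS).
rewrite -S'E; case: ifP => _; first by rewrite !inE nxp.
by case: ifP => _; rewrite ?inE ?(negPf nxp).
Qed.

(* Toggling rank by rank from rank [s] upwards replaces the part of [B] of rank
   at least [s] by the minimal elements, among those of rank at least [s] that
   avoid the filter of the low part of [B], of the complement of the ideal of
   [B]; the hypotheses on [C] characterize this set. *)
Lemma partial_rowmotion s r B C : antichain B -> antichain C ->
  (forall p, rk p <= r) -> (forall p, rk p < s -> (p \in C) = (p \in B)) ->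
  (forall p q, p \in C -> s <= rk p -> q \in B -> ~~ (p <= q)%O) ->
  (forall p, s <= rk p -> (forall q, q \in B -> ~~ (p <= q)%O) ->
     exists2 q, q \in C & (q <= p)%O) ->
  (\big[comp/id]_(i <- rev (index_iota s r.+1)) rank_toggle rk i) B = C.
Proof.
move=> aB aC rk_r lowE CB Cmin.
have rk_eq p q : (p <= q)%O -> p != q -> rk p < rk q.
  by move=> le npq; apply: rkS; rewrite lt_neqAle npq.
(* After [k] ranks, the set agrees with [C] below rank [s + k] and still with [B] from there on. *)
suff H k : let S := (\big[comp/id]_(i <- rev (iota s k)) rank_toggle rk i) B in
    antichain S /\ forall p, (p \in S) = if rk p < s + k then p \in C else p \in B.
  apply/setP => p; rewrite /index_iota; case: (H (r.+1 - s)) => _ ->.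
  by have := rk_r p; case: ifP => //; lia.
elim: k => [|k IH].
  by rewrite big_nil; split=> // p; rewrite addn0; case: ifP => // /lowE.
rewrite -addn1 iotaD rev_cat /= big_cons /=.
case: IH => /=; set S := (\big[_/_]_(_ <- _) _) B => aS SE.
split=> [|p]; first exact: rank_toggle_antichain.
rewrite in_rank_toggle // SE addn1 addnS ltnS.
case: (ltngtP (rk p) (s + k)) => [//|//|rp].
have sp : s <= rk p by lia.
have pS : (p \in S) = (p \in B) by rewrite SE rp ltnn.
case: (boolP (p \in B)) => pB /=.
  by apply/esym/negP => pC; have := CB _ _ pC sp pB; rewrite lexx.
rewrite antichainU1 ?pS //; apply/forall_inP/idP => [nc|pC q].
  have [q qB|q qC le_qp] := Cmin p sp.
    apply/negP => le_pq; have npq : p != q by apply: contraNneq pB => ->.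
    have := nc q; rewrite SE; have := rk_eq _ _ le_pq npq; rewrite rp => lt.
    by rewrite ltnNge (ltnW lt) qB /Order.comparable le_pq => /(_ isT).
  case: (eqVneq q p) => [<- //|nqp].
  have := nc q; have := rk_eq _ _ le_qp nqp; rewrite SE rp => ->.
  by rewrite qC /Order.comparable le_qp orbT => /(_ isT).
rewrite SE; case: ifP => [lt qC|/negbT nlt qB].
  by apply/negP => /orP[] le; move/antichainP: aC => aC;
    move: lt; rewrite -rp ?(aC _ _ pC qC le) -?(aC _ _ qC pC le) ltnn.
apply/negP => /orP[le|le]; first by have := CB _ _ pC sp qB; rewrite le.
case: (eqVneq q p) => [e|nqp]; first by rewrite -e qB in pB.
by have := rk_eq _ _ le nqp; rewrite rp (negPf nlt).
Qed.

End Rowmotion.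

(** [enum] is increasing, so the position of [x] counts the smaller elements of [X]; the bound on
    [k] rules out the default [x0]. *)
Lemma nth_enum_set n (X : {set 'I_n}) (x0 x : 'I_n) k :
  (k < #|X|) && (nth x0 (enum X) k == x) =
  (x \in X) && (#|[set z in X | z < x]| == k).
Proof.
have szX : size (enum X) = #|X| by rewrite cardE.
have idx y : y \in X -> #|[set z in X | z < y]| = index y (enum X).
  move=> yX.
  have -> : index y (enum X) = index (val y) (map val (enum X)).
    by rewrite index_map //; apply: val_inj.
  have ylt : index (val y) (map val (enum X)) < size (map val (enum X)).
    by rewrite index_mem mem_map ?mem_enum //; apply: val_inj.
  have lt_sorted : sorted <%O (map val (enum X)) by exact: sorted_enum_set.
  rewrite -[RHS](count_lt_nth 0 lt_sorted ylt).
  rewrite nth_index ?mem_map ?mem_enum //; last exact: val_inj.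
  rewrite count_map -size_filter cardE /enum_mem -filter_predI.
  by congr (size _); apply: eq_filter => z; rewrite /= !inE andbC.
apply/andP/andP => [[kX /eqP<-]|[xX /eqP<-]]; last first.
  by rewrite idx // -szX index_mem nth_index ?mem_enum.
have yX : nth x0 (enum X) k \in X by rewrite -mem_enum mem_nth ?szX.
by rewrite yX idx // index_uniq ?szX ?enum_uniq.
Qed.

(** * Counting functions and stages of an antichain of intervals *)

Section Antichain.
Context (n : nat) (A : {set intv n}) (aA : antichain A).
Implicit Types (p q : intv n).

Definition lefts_below x := #|[set p in A | left p < x]|.
Definition rights_below x := #|[set p in A | right p < x]|.

(** By injectivity, at most one element of [A] has its end at [x]. *)
Lemma card_below_step (f : intv n -> 'I_n) x : {in A &, injective f} ->
  #|[set p in A | f p < x.+1]| =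
  #|[set p in A | f p < x]| + (x \in [seq val (f p) | p in A]).
Proof.
move=> fI; case: imageP => [[p pA ->]|nx].
  have -> : [set q in A | f q < (f p).+1] = p |: [set q in A | f q < f p].
    apply/setP => q; rewrite !inE ltnS leq_eqVlt.
    case: (eqVneq q p) => [->|nqp]; first by rewrite eqxx pA.
    case: (boolP (q \in A)) => //= qA; case: eqP => // /val_inj /fI.
    by move=> /(_ qA pA) e; rewrite e eqxx in nqp.
  by rewrite cardsU1 !inE ltnn andbF addnC.
rewrite addn0; apply: eq_card => q; rewrite !inE ltnS leq_eqVlt.
case: (boolP (q \in A)) => //= qA; case: eqP => // e.
by case: nx; exists q; rewrite // e.
Qed.

Lemma lefts_step x : lefts_below x.+1 = lefts_below x + (x \in [seq val (left p) | p in A]).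
Proof. exact/card_below_step/antichain_left_inj. Qed.

Lemma rights_step x : rights_below x.+1 = rights_below x + (x \in [seq val (right p) | p in A]).
Proof. exact/card_below_step/antichain_right_inj. Qed.

Lemma lefts_unit_step : unit_step lefts_below.
Proof. by move=> x; rewrite lefts_step; case: (_ \in _); lia. Qed.

Lemma rights_unit_step : unit_step rights_below.
Proof. by move=> x; rewrite rights_step; case: (_ \in _); lia. Qed.

Lemma lefts_below0 : lefts_below 0 = 0.
Proof. by apply/eqP; rewrite cards_eq0; apply/eqP/setP => p; rewrite !inE andbF. Qed.

Lemma rights_below0 : rights_below 0 = 0.
Proof. by apply/eqP; rewrite cards_eq0; apply/eqP/setP => p; rewrite !inE andbF. Qed.

Lemma rights_le_lefts x : rights_below x <= lefts_below x.
Proof.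
apply/subset_leq_card/subsetP => p; rewrite !inE => /andP[-> /=].
exact: leq_ltn_trans (left_le_right p).
Qed.

Lemma lefts_rights_n : lefts_below n = rights_below n.
Proof. by apply: eq_card => p; rewrite !inE !ltn_ord. Qed.

(** In an antichain, left ends and right ends come in the same order. *)
Lemma lefts_rights p : p \in A -> lefts_below (left p) = rights_below (right p).
Proof.
move=> pA; apply: eq_card => q; rewrite !inE; case: (boolP (q \in A)) => //= qA.
move/antichainP: (aA) => aP; apply/idP/idP => lt; rewrite ltnNge; apply/negP => le.
  by move: (lt); rewrite (aP p q) ?ltnn // intv_leE (ltnW lt).
by move: (lt); rewrite (aP q p) ?ltnn // intv_leE le (ltnW lt).
Qed.

Definition stage s : {set intv n} :=
  [set p | stage_cond lefts_below rights_below s (left p) (right p)].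

Lemma intv_exists x y : x <= y -> y < n ->
  exists p : intv n, left p = x :> nat /\ right p = y :> nat.
Proof.
move=> xy yn.
have xy' : (Ordinal (leq_ltn_trans xy yn), Ordinal yn).1 <=
           (Ordinal (leq_ltn_trans xy yn), Ordinal yn).2 by [].
by exists (Intv xy').
Qed.

Lemma intv_eq p q : left p = left q :> nat -> right p = right q :> nat -> p = q.
Proof. by move=> el er; apply/le_anti; rewrite !intv_leE el er !leqnn. Qed.

Lemma stage0 : stage 0 = A.
Proof.
apply/setP => p; rewrite inE /stage_cond ltn0 /= /shifted_cond !addn0 subn0.
rewrite left_le_right lefts_step rights_step /=.
apply/and3P/idP => [[hl hr /eqP e]|pA].
  have : val (left p) \in [seq val (left q) | q in A] by move: hl; case: (_ \in _); lia.
  have : val (right p) \in [seq val (right q) | q in A] by move: hr; case: (_ \in _); lia.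
  case/imageP=> q qA rE /imageP[q' qA' lE].
  have e' : lefts_below (left q') = lefts_below (left q).
    by rewrite (lefts_rights qA); move: e; rewrite lE rE.
  (* [q'] and [q] have equal indices, and [lefts_below] steps up after each left end of [A], hence
     separates distinct left ends. *)
  suff eq : q' = q by rewrite -eq in rE; rewrite (intv_eq lE rE).
  apply: (antichain_left_inj aA) => //; apply: val_inj.
  have lS z : z \in A -> lefts_below (left z).+1 = (lefts_below (left z)).+1.
    by move=> zA; rewrite lefts_step (image_f (fun p => val (left p))) ?addn1.
  have := lS _ qA; have := lS _ qA'.
  have := @unit_step_leq _ (left q).+1 (left q') lefts_unit_step.
  have := @unit_step_leq _ (left q').+1 (left q) lefts_unit_step.
  by rewrite /=; lia.
rewrite (image_f (fun p => val (left p))) // (image_f (fun p => val (right p))) //.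
by rewrite lefts_rights // !addn1 !leqnn.
Qed.

(** The points below [x] split into ends and others, which makes [x - lefts_below x] and
    [x - rights_below x] indices among the others. *)
Lemma card_compl_below (f : intv n -> 'I_n) (x : 'I_n) : {in A &, injective f} ->
  #|[set z in ~: [set f p | p in A] | z < x]| + #|[set p in A | f p < x]| = x.
Proof.
move=> fI; have -> : #|[set p in A | f p < x]| = #|[set z in [set f p | p in A] | z < x]|.
  rewrite -(@card_in_imset _ _ f); last first.
    by move=> p q; rewrite !inE => /andP[pA _] /andP[qA _]; apply: fI.
  congr #|pred_of_set _|; apply/setP => z; rewrite !inE.
  apply/imsetP/andP => [[p]|[/imsetP[p pA ->] lt]].
    by rewrite inE => /andP[pA pm] ->; split=> //; apply: imset_f.
  by exists p; rewrite // inE pA.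
have := cardsID [set f p | p in A] [set z : 'I_n | z < x].
have -> : #|[set z : 'I_n | z < x]| = x.
  have -> : [set z : 'I_n | z < x] = [set widen_ord (ltnW (ltn_ord x)) z | z : 'I_x].
    apply/setP => z; rewrite inE; apply/idP/imsetP => [lt|[y _ ->]]; last exact: (ltn_ord y).
    by exists (Ordinal lt) => //; apply: val_inj.
  rewrite card_imset ?card_ord // => y z /(congr1 val) /= e; exact: val_inj.
move=> e; rewrite -[RHS]e addnC; congr (_ + _);
  by apply: eq_card => z; rewrite !inE andbC.
Qed.

Lemma in_compl_image (f : intv n -> 'I_n) (x : 'I_n) :
  (x \in ~: [set f p | p in A]) = (val x \notin [seq val (f p) | p in A]).
Proof.
rewrite inE; congr (~~ _); apply/imsetP/imageP => [[p pA ->]|[p pA /val_inj->]];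
  by exists p.
Qed.

(** Zipped points have equal positions in the two enumerations, and [LK_cond] equates these
    positions. *)
Lemma in_LK p : (p \in LK A) = LK_cond lefts_below rights_below (left p) (right p).
Proof.
rewrite inE /LK_endpoints; set R := ~: _; set L := ~: _.
have eRL : #|R| = #|L| by exact: LK_endpoints_size.
have cR := card_compl_below (left p) (antichain_right_inj aA).
have cL := card_compl_below (right p) (antichain_left_inj aA).
have -> : LK_cond lefts_below rights_below (left p) (right p) =
  [&& left p \in R, right p \in L &
     #|[set z in R | z < left p]| == #|[set z in L | z < right p]|].
  rewrite /LK_cond lefts_step rights_step !in_compl_image.
  rewrite -/R -/L -/(rights_below _) -/(lefts_below _) in cR cL.
  have -> : (left p + lefts_below (right p) == right p + rights_below (left p)) =
     (#|[set z in R | z < left p]| == #|[set z in L | z < right p]|).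
    by apply/eqP/eqP; lia.
  by rewrite andbCA; congr [&& _, _ & _]; case: (_ \in _); rewrite /=; lia.
have szR : size (enum R) = #|R| by rewrite cardE.
have szL : size (enum L) = #|L| by rewrite cardE.
have szE : size (enum R) = size (enum L) by rewrite szR szL.
apply/idP/and3P => [|[lR rL /eqP e]].
  case/(nthP (left p, right p)) => k; rewrite size_zip szE minnn szL => kL.
  rewrite nth_zip // => e.
  have [e1 e2] : nth (left p) (enum R) k = left p /\ nth (right p) (enum L) k = right p.
    by split; [exact: (congr1 fst e)|exact: (congr1 snd e)].
  have := nth_enum_set R (left p) (left p) k.
  rewrite e1 eRL kL eqxx => /esym/andP[-> /eqP->].
  have := nth_enum_set L (right p) (right p) k.
  by rewrite e2 kL eqxx => /esym/andP[-> /eqP->].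
have := nth_enum_set R (left p) (left p) #|[set z in L | z < right p]|.
have := nth_enum_set L (right p) (right p) #|[set z in L | z < right p]|.
rewrite lR rL e eqxx => /andP[kL /eqP e2] /andP[_ /eqP e1].
apply/(nthP (left p, right p)); exists #|[set z in L | z < right p]|.
  by rewrite size_zip szE minnn szL.
by rewrite nth_zip // e1 e2 -surjective_pairing.
Qed.

(** Every rank is below [n], so no interval shifted by [n] exists. *)
Lemma stage_n : stage n = LK A.
Proof.
apply/setP => p; rewrite in_LK inE /stage_cond /shifted_cond.
have := ltn_ord (right p); case: (LK_cond _ _ _ _) => /= lt; last by lia.
by apply/orP; left; lia.
Qed.

Lemma stage_antichain s : antichain (stage s).
Proof.
apply/antichainP => p q; rewrite !inE => ps qs; rewrite intv_leE => /andP[le1 le2].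
have [||el er] := stage_cond_inj lefts_unit_step rights_unit_step _ _ qs ps le1 le2.
- exact: left_le_right.
- exact: left_le_right.
by apply/intv_eq.
Qed.

Lemma rk_lt p q : (p < q)%O -> rk p < rk q.
Proof.
rewrite lt_neqAle intv_leE /rk => /andP[npq /andP[le1 le2]].
have lp := left_le_right p; rewrite ltnNge; apply: contra npq => le; apply/eqP/intv_eq; lia.
Qed.

Lemma stage_next s :
  (\big[comp/id]_(i <- rev (index_iota s n.-1.+1)) rank_toggle (@rk n) i) (stage s) =
  stage s.+1.
Proof.
apply: partial_rowmotion => [|||p|p|p q|p sp nle].
- exact: rk_lt.
- exact: stage_antichain.
- exact: stage_antichain.
- by have := ltn_ord (right p); rewrite /rk; lia.
(* Below rank [s] there are no shifted intervals, and the [LK_cond] part is common to both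
   stages. *)
- rewrite !inE /stage_cond /shifted_cond /rk => lt.
  by have lp := left_le_right p; rewrite lt ltnS ltnW //=; congr orb; lia.
- rewrite inE => pC sp qB; have lp := left_le_right p.
  have le := stage_cond_next rights_unit_step sp lp pC.
  apply/negP; rewrite intv_leE => /andP[l1 l2].
  (* Containing [p], [q] has rank at least [s], so it is a shifted interval. *)
  move: qB; rewrite inE => /orP[/andP[lt _]|qB]; first by rewrite /rk in sp; lia.
  rewrite /rk in sp; have sp' : left p + s <= right p by lia.
  have [H _] := @below_shifted _ _ lefts_unit_step rights_unit_step
    n s (left p) (right p) lefts_below0 lefts_rights_n sp' (ltn_ord _).
  have : rights_below (right p - s) + s < lefts_below (left p + s).+1.
    by apply: H; exists (left q), (right q).
  by rewrite ltnNge le.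
have lp := left_le_right p; rewrite /rk in sp.
have sp' : left p + s <= right p by lia.
have [_ H] := @below_shifted _ _ lefts_unit_step rights_unit_step
  n s (left p) (right p) lefts_below0 lefts_rights_n sp' (ltn_ord _).
have [|x [y [h1 h2 h3 h4]]] := @stage_cond_exists _ _
  lefts_unit_step rights_unit_step s (left p) (right p)
  lefts_below0 rights_below0 rights_le_lefts sp'.
  (* Otherwise [below_shifted] would produce an element of [stage s] containing [p]. *)
  rewrite leqNgt; apply/negP => /H[x [y [h1 h2 h3 h4]]].
  have [|//|q [lq rq]] := @intv_exists x y; first by case/and4P: h1; lia.
  have := nle q; rewrite inE intv_leE /stage_cond lq rq h1 h2 h3 orbT.
  by move=> /(_ isT).
have [//||q [lq rq]] := @intv_exists x y; first exact: leq_ltn_trans h3 (ltn_ord _).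
by exists q; rewrite ?inE ?intv_leE lq rq ?h1 ?h2 ?h3.
Qed.

End Antichain.

Theorem theorem3p5 (n : nat) (n_ge1 : 1 <= n) (A : {set intv n})
    (A_antichain : antichain A) :
  LK A = rvac (@rk n) n.-1 A.
Proof.
rewrite /rvac; under eq_bigr do rewrite (prednK n_ge1).
(* Induction on the number [m] of factors applied: the list is reversed, so factor [m] comes at its
   head and acts last, on [stage A m]. *)
suff -> m : (\big[comp/id]_(k <- rev (iota 0 m))
    \big[comp/id]_(i <- rev (index_iota k n)) rank_toggle (@rk n) i) A = stage A m.
  by rewrite /index_iota subn0 prednK // stage_n.
elim: m => [|m IH]; first by rewrite big_nil stage0.
rewrite -addn1 iotaD rev_cat /= big_cons /= IH addn1 -stage_next //.
by rewrite prednK.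
Qed.
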